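(* Let $X_x$ be a Toeplitz system with an essential period $s$, and let $y\in X_x$. If $(a_n)_{n\ge1}$ is a sequence of integers such that $\left(\sigma^{a_n}y\right)_{n\ge1}$ is dense in $X_x$, then $(a_n)$ gives a full set of residues modulo $s$, i.e. for every $i\in\{0,\dots,s-1\}$ there is $n$ with $a_n\equiv i\pmod s$.
   Context: Let $\sigma$ be the left shift on $\{0,1\}^{\mathbb{Z}}$ (product topology), $(\sigma y)(i)=y(i+1)$. A word $x\in\{0,1\}^{\mathbb{Z}}$ is called a Toeplitz word if for every $a\in\mathbb{Z}$ there exists $\ell\in\mathbb{Z}^+$ such that $x(a)=x(a+j\ell)$ for all $j\in\mathbb{Z}$. The Toeplitz system $X_x$ is the orbit closure $\overline{\{\sigma^n x:n\in\mathbb{Z}\}}$ in $\{0,1\}^{\mathbb{Z}}$ with the action of $\sigma$; it is minimal. For $s\in\mathbb{Z}^+$ let $\mathrm{Per}_s(x)=\{a\in\mathbb{Z}: x(a)=x(a+js)\text{ for all }j\in\mathbb{Z}\}$. An essential period of a Toeplitz word $x$ is a positive integer $s$ such that $\mathrm{Per}_s(x)$ is nonempty and $\mathrm{Per}_s(x)\neq\mathrm{Per}_{s'}(x)$ for every positive integer $s'<s$. All Toeplitz words in $X_x$ have the same essential periods, and these are called the essential periods of the Toeplitz system $X_x$. *)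

(* Defs.v *)
From mathcomp Require Import all_boot all_order all_algebra.
From mathcomp Require Import all_classical topology.
Set Implicit Arguments.
Unset Strict Implicit.
Unset Printing Implicit Defensive.
Import Order.TTheory GRing.Theory Num.Theory.
Local Open Scope classical_set_scope.
Local Open Scope ring_scope.

(* [bool] carries the discrete topology, so this is the product topology on
   {0,1}^Z. *)
Notation biseq := {ptws int -> bool}.

Definition shift (y : biseq) : biseq := fun i => y (i + 1).
Definition unshift (y : biseq) : biseq := fun i => y (i - 1).

Lemma shiftK : cancel shift unshift.
Proof. by move=> y; apply/funext => i; rewrite /unshift /shift subrK. Qed.

Lemma unshiftK : cancel unshift shift.
Proof. by move=> y; apply/funext => i; rewrite /unshift /shift addrK. Qed.

Definition shift_pow (n : int) (y : biseq) : biseq :=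
  match n with
  | Posz k => iter k shift y
  | Negz k => iter k.+1 unshift y
  end.

Lemma shift_powE (n : int) (y : biseq) (i : int) :
  shift_pow n y i = y (i + n).
Proof.
have it_shift k j : iter k shift y j = y (j + k%:Z).
  elim: k j => [|k IH] j; first by rewrite addr0.
  by rewrite iterS {1}/shift IH -addrA intS.
have it_unshift k j : iter k unshift y j = y (j - k%:Z).
  elim: k j => [|k IH] j; first by rewrite subr0.
  by rewrite iterS {1}/unshift IH -addrA intS opprD.
by case: n => k; rewrite /shift_pow ?it_shift ?it_unshift ?NegzE.
Qed.

Definition toeplitz (x : biseq) : Prop :=
  forall a : int, exists2 l : nat, (0 < l)%N &
    forall j : int, x a = x (a + j * l%:Z).

Definition toeplitz_system (x : biseq) : set biseq :=
  closure [set shift_pow n x | n in [set: int]].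

Definition Per (s : nat) (x : biseq) : set int :=
  [set a | forall j : int, x a = x (a + j * s%:Z)].

Definition essential_period (x : biseq) (s : nat) : Prop :=
  [/\ (0 < s)%N, Per s x !=set0 &
      forall s' : nat, (0 < s')%N -> (s' < s)%N -> Per s x <> Per s' x].

(* All Toeplitz words of a Toeplitz system have the same essential periods, so
   it does not matter which of them is used. *)
Definition system_essential_period (X : set biseq) (s : nat) : Prop :=
  exists z : biseq, [/\ X z, toeplitz z & essential_period z s].

Definition dense_in (X : set biseq) (u : nat -> biseq) : Prop :=
  range u `<=` X /\ X `<=` closure (range u).

(* Main.v *)
(** Fix a word [z] of the system with essential period [s], and let [S_i] be the
    set of words that agree with the [i]-th translate of [z] wherever that
    translate is [s]-periodic.  The [S_i] are closed, depend only on [i] modulo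
    [s], are permuted cyclically by the shift, and cover the orbit of [z], hence
    (by minimality) the whole system.  If a translate of [z] by [k] lies in
    [S_j], then [k - j] is a period of the [s]-periodic part of [z], so that part
    is already [gcd(k - j, s)]-periodic, and essentiality forces
    [k = j] modulo [s].  Now [y] lies in some [S_i0], and approximating the translate of
    [z] by [i0 + i] with the words [shift_pow (a n) y], which lie in
    [S_(i0 + a n)], yields some [n] with [i0 + i = i0 + a n] modulo [s]. *)

Require Import Defs.
From mathcomp Require Import all_boot all_order all_algebra.
From mathcomp Require Import all_classical topology.
From mathcomp Require Import ring.
Import GRing.Theory.
Local Open Scope classical_set_scope.
Local Open Scope ring_scope.

Lemma continuous_coordinate (i : int) : continuous (fun u : biseq => u i).
Proof. exact: (@proj_continuous int (fun=> bool) i). Qed.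

Lemma continuous_shift_pow (n : int) : continuous (shift_pow n).
Proof.
move=> u; apply/cvg_sup => i.
apply: (@continuous_comp_initial biseq biseq bool (fun v => v i)).
have -> : (fun v : biseq => v i) \o shift_pow n = (fun v : biseq => v (i + n)).
  by apply/funext => v /=; rewrite shift_powE.
exact: continuous_coordinate.
Qed.

Lemma closure_agree (A : set biseq) (w : biseq) : closure A w ->
  forall F : seq int, exists u, A u /\ {in F, u =1 w}.
Proof.
move=> Aw F; suff /Aw[u [Au uF]] : nbhs w [set u : biseq | {in F, u =1 w}].
  by exists u.
elim: F => [|c F IH]; first exact: filterS filterT.
have c_near : nbhs w [set u : biseq | u c = w c].
  by apply: (continuous_coordinate c w [set w c]).
apply: filterS (filterI c_near IH) => u [/= uc uF] e.
by rewrite inE => /predU1P[->|/uF].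
Qed.

Lemma toeplitz_system_shift {x u : biseq} (m : int) :
  toeplitz_system x u -> toeplitz_system x (shift_pow m u).
Proof.
have /closure_id cl : closed (shift_pow m @^-1` toeplitz_system x).
  apply: ((continuous_closedP (shift_pow m)).1 (continuous_shift_pow m)).
  exact: closed_closure.
suff : toeplitz_system x `<=` shift_pow m @^-1` toeplitz_system x by exact.
rewrite cl; apply: closureS => _ [n _ <-].
apply: subset_closure; exists (m + n) => //; apply/funext => i.
by rewrite !shift_powE addrA.
Qed.

Lemma toeplitz_common_period (x : biseq) (F : seq int) : toeplitz x ->
  exists2 l : nat, (0 < l)%N &
    {in F, forall (c : int), forall j : int, x c = x (c + j * l%:Z)}.
Proof.
move=> hx; elim: F => [|c F [l l0 lF]]; first by exists 1%N.
have [k k0 kc] := hx c; exists (k * l)%N; first by rewrite muln_gt0 k0.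
move=> e; rewrite inE => /predU1P[-> j|/lF eF j].
  by rewrite (kc (j * l%:Z)) PoszM; congr (x (_ + _)); ring.
by rewrite (eF (j * k%:Z)) PoszM mulrA.
Qed.

(** This is minimality: the positions in [F] share a period [l] of [x], and if [z] matches the
    translate of [x] by [n] on a long enough window, a further shift by [- n] modulo [l] restores
    [x] on [F]. *)
Lemma toeplitz_system_sym (x z : biseq) (F : seq int) :
  toeplitz x -> toeplitz_system x z ->
  exists r : int, {in F, shift_pow r z =1 x}.
Proof.
move=> hx xz; have [l l0 lF] := toeplitz_common_period _ F hx.
have l0' : l%:Z != 0 by rewrite -lt0n.
(* [n] is known only once the window is fixed, so the window allows for every remainder [r] modulo
   [l]. *)
pose G := [seq c + (r : nat)%:Z | c <- F, r <- iota 0 l].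
have [_ [[n _ <-]] nG] := closure_agree _ _ xz G.
have [r rE] : exists r : nat, (- n %% l%:Z)%Z = r%:Z.
  by have := modz_ge0 (- n) l0'; case: modz => // r; exists r.
have rl : (r < l)%N.
  by have := ltz_pmod (- n) (d := l%:Z); rewrite rE => /(_ l0).
exists r%:Z => c cF; rewrite shift_powE -nG; last first.
  by apply/allpairsP; exists (c, r); rewrite mem_iota.
rewrite shift_powE [RHS](lF c cF (- (- n %/ l%:Z)%Z)); congr (x _).
have := divz_eq (- n) l%:Z; rewrite rE; move: (_ %/ _)%Z => q nE.
by rewrite -[n]opprK nE; ring.
Qed.

Lemma PerD (s : nat) (z : biseq) (b q : int) :
  Per s z b -> Per s z (b + q * s%:Z).
Proof. by move=> zb j; rewrite -addrA -mulrDl -!zb. Qed.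

(** The set [S_i], indexed by positions [b] of [z] so that all classes quantify over the same
    set. *)
Definition skeleton_class (s : nat) (z : biseq) (i : int) : set biseq :=
  [set w | forall b, Per s z b -> w (b - i) = z b].

Lemma skeleton_class_shift (s : nat) (z w : biseq) (i m : int) :
  skeleton_class s z i w -> skeleton_class s z (i + m) (shift_pow m w).
Proof.
by move=> iw b /iw <-; rewrite shift_powE; congr (w _); ring.
Qed.

Lemma skeleton_class0 (s : nat) (z : biseq) : skeleton_class s z 0 z.
Proof. by move=> b _; rewrite subr0. Qed.

Lemma skeleton_class_mod (s : nat) (z w : biseq) (i j : int) :
  (i = j %[mod s%:Z])%Z -> skeleton_class s z i w -> skeleton_class s z j w.
Proof.
move=> /eqP; rewrite eqz_mod_dvd => /dvdzP[q ijE] iw b zb.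
rewrite (zb q) -(iw _ (PerD _ _ _ q zb)) -ijE; congr (w _); ring.
Qed.

(* A finite union of the closed classes is closed: one coordinate per residue
   refutes membership. *)
Lemma skeleton_class_closed (s : nat) (z w : biseq) (P : set int) : (0 < s)%N ->
  (forall F : seq int, exists i u,
     [/\ P i, skeleton_class s z i u & {in F, u =1 w}]) ->
  exists2 i, P i & skeleton_class s z i w.
Proof.
move=> s0 Fw; apply: contrapT => nPw.
have s0' : s%:Z != 0 by rewrite -lt0n.
have refute (r : 'I_s) : exists c : int, forall i u, P i ->
    (i %% s%:Z)%Z = (r : nat)%:Z -> skeleton_class s z i u -> u c <> w c.
  have [[i [Pi ir]]|nPr] :=
    pselect (exists i, P i /\ (i %% s%:Z)%Z = (r : nat)%:Z); last first.
    (* No index in [P] has residue [r]: the condition is vacuous and 0 is arbitrary. *)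
    by exists 0 => i u Pi ir; case: nPr; exists i.
  have /existsNP[b /not_implyP[zb wb]] : ~ skeleton_class s z i w.
    by move=> iw; apply: nPw; exists i.
  exists (b - i) => j u Pj jr ju.
  rewrite (skeleton_class_mod s z u j i _ ju b zb) ?jr ?ir //.
  exact/nesym.
have [f fP] := choice refute.
have [i [u [Pi iu uF]]] := Fw [seq f r | r <- enum 'I_s].
have [r rE] : exists r : 'I_s, (i %% s%:Z)%Z = (r : nat)%:Z.
  have := ltz_pmod i (d := s%:Z); have := modz_ge0 i s0'.
  by case: modz => // r _ /(_ s0) rs; exists (Ordinal rs).
by apply: (fP r i u Pi rE iu); apply: uF; apply: map_f; rewrite mem_enum.
Qed.

(** Translation by [d] preserves [Per s z], so it can be iterated; Bezout then gives
    [Per s z = Per g z] for the gcd [g], which minimality of [s] forbids when [g < s]. *)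
Lemma essential_period_dvd (z : biseq) (s : nat) (d : int) :
  essential_period z s -> (forall b, Per s z b -> z (b + d) = z b) ->
  (s%:Z %| d)%Z.
Proof.
move=> [s0 _ smin] zd.
have PerDd b : Per s z b -> Per s z (b + d).
  by move=> zb j; rewrite addrAC !zd //; exact: PerD.
have zdn (n : nat) b : Per s z b ->
    Per s z (b + n%:Z * d) /\ z (b + n%:Z * d) = z b.
  elim: n => [|n IH] zb; first by rewrite mul0r addr0.
  have [zbn zbnE] := IH zb.
  have -> : b + n.+1%:Z * d = b + n%:Z * d + d by rewrite intS; ring.
  by split; [exact: PerDd|rewrite zd].
(* Negative [k] are covered by passing to the remainder modulo [s], as [s * d] is a multiple of
   [s]. *)
have zdk (k l : int) b : Per s z b -> z (b + k * d + l * s%:Z) = z b.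
  have s0' : s%:Z != 0 by rewrite -lt0n.
  have [n nE] : exists n : nat, (k %% s%:Z)%Z = n%:Z.
    by have := modz_ge0 k s0'; case: modz => // n; exists n.
  move=> zb; have [zbn <-] := zdn n b zb.
  rewrite (zbn ((k %/ s%:Z)%Z * d + l)); congr (z _).
  by have := divz_eq k s%:Z; rewrite nE => {1}->; ring.
pose g := gcdn `|d| s.
have gs : (g %| s)%N by exact: dvdn_gcdr.
have [gls|sg] := ltnP g s; last first.
  have /eqP gE : g == s by rewrite eqn_leq sg dvdn_leq.
  by rewrite dvdzE absz_nat -{1}gE dvdn_gcdl.
have g0 : (0 < g)%N by rewrite gcdn_gt0 s0 orbT.
case: (smin g g0 gls); apply/seteqP; split=> b zb j.
  have [u [v uv]] := Bezoutz d s%:Z.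
  have -> : g%:Z = u * d + v * s%:Z by rewrite uv.
  by rewrite -(zdk (j * u) (j * v) b zb); congr (z _); ring.
have /dvdnP[q sE] := gs.
by rewrite (zb (j * q%:Z)); congr (z (_ + _)); rewrite sE PoszM; ring.
Qed.

Theorem theorem5p2 (x : biseq) (hx : toeplitz x) (s : nat)
    (hs : system_essential_period (toeplitz_system x) s)
    (y : biseq) (hy : toeplitz_system x y) (a : nat -> int)
    (ha : dense_in (toeplitz_system x) (fun n => shift_pow (a n) y)) :
  forall i : nat, (i < s)%N -> exists n : nat, (a n = i%:Z %[mod s%:Z])%Z.
Proof.
move=> i _; have [z [xz _ zs]] := hs; have [s0 _ _] := zs.
have zshift m : skeleton_class s z m (shift_pow m z).
  by rewrite -[m in skeleton_class _ _ m]add0r;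
    apply: skeleton_class_shift; exact: skeleton_class0.
have [ix _ ixP] : exists2 i, [set: int] i & skeleton_class s z i x.
  apply: skeleton_class_closed => // F.
  have [r rF] := toeplitz_system_sym x z F hx xz.
  by exists r, (shift_pow r z).
have [iy _ iyP] : exists2 i, [set: int] i & skeleton_class s z i y.
  apply: skeleton_class_closed => // F.
  have [_ [[n _ <-] nF]] := closure_agree _ _ hy F.
  by exists (ix + n), (shift_pow n x); split=> //; exact: skeleton_class_shift.
pose k := iy + i%:Z.
(* Density yields an [n] that varies with the window [F]; as there are finitely many classes, one
   [n] serves for all windows. *)
have [_ [n _ <-] nP] : exists2 j, range (fun n => iy + a n) j &
    skeleton_class s z j (shift_pow k z).
  apply: skeleton_class_closed => // F.
  have [_ [[n _ <-] nF]] :=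
    closure_agree _ _ (ha.2 _ (toeplitz_system_shift k xz)) F.
  exists (iy + a n), (shift_pow (a n) y).
  by split=> //; exact: skeleton_class_shift.
exists n; apply/esym/eqP; rewrite eqz_mod_dvd.
(* The offset [k - (iy + a n)] is [i - a n]: the unknown class [iy] of [y] cancels. *)
apply: essential_period_dvd zs _ => b /nP; rewrite shift_powE => <-.
by congr (z _); rewrite /k; ring.
Qed.
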